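(* Let $\mathcal{A}$ be a decomposable class of graphs, let $\tau=(\lambda,\nu)$ with $\lambda,\nu>0$, and let $\rho>0$ be such that $A(\rho,\tau)$ is finite. For each unlabelled graph $H$ in $\mathcal{U}\mathcal{A}$ let \[\mu(H)=\frac{\rho^{v(H)}\lambda^{e(H)}\nu^{\kappa(H)}}{\mathrm{aut}(H)}\] (so that $A(\rho,\tau)=\sum_{H\in\mathcal{U}\mathcal{A}}\mu(H)$). Let the Boltzmann Poisson random graph $R=R(\mathcal{A},\rho,\tau)$ take values in $\mathcal{U}\mathcal{A}$ with $\Pr[R=H]=\mu(H)/A(\rho,\tau)$ for each $H\in\mathcal{U}\mathcal{A}$. Let $\mathcal{C}$ be the class of connected graphs in $\mathcal{A}$. Then the random variables $\kappa(R,H)$, for $H\in\mathcal{U}\mathcal{C}$, are independent, with $\kappa(R,H)\sim\mathrm{Po}(\mu(H))$.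
   Context: Graph classes are closed under isomorphism; $\mathcal{A}_n$ is the set of graphs in $\mathcal{A}$ on vertex set $[n]$, and by convention the empty graph (no vertices) belongs to $\mathcal{A}$ but not to the class of connected graphs. $\mathcal{A}$ is decomposable if a graph is in $\mathcal{A}$ if and only if each of its components is. For a graph $G$, $v(G)$, $e(G)$, $\kappa(G)$, $\mathrm{aut}(G)$ denote the numbers of vertices, edges, components and automorphisms. $A(x,\tau)=\sum_{n\ge 0}\sum_{G\in\mathcal{A}_n}\frac{x^n}{n!}\lambda^{e(G)}\nu^{\kappa(G)}$ is the exponential generating function. $\mathcal{U}\mathcal{A}$ denotes the set of unlabelled graphs (isomorphism classes) of graphs in $\mathcal{A}$. For a connected graph $H$, $\kappa(G,H)$ is the number of components of $G$ isomorphic to $H$. $\mathrm{Po}(\mu)$ is the Poisson distribution with mean $\mu$. *)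

(* Defs.v *)
From HB Require Import structures.
From mathcomp Require Import all_boot all_order all_algebra all_fingroup finmap.
From mathcomp Require Import all_classical all_reals all_analysis.
From mathcomp Require Import generic_quotient.

Set Implicit Arguments.
Unset Strict Implicit.
Unset Printing Implicit Defensive.
Set Warnings "-redundant-canonical-projection".

Import Order.TTheory GRing.Theory Num.Theory.
Import numFieldNormedType.Exports.

Local Open Scope classical_set_scope.
Local Open Scope ring_scope.
Local Open Scope quotient_scope.

(* A finite simple graph on V is its set of edges, a set of 2-subsets of V. *)
Record sgraph (V : finType) : predArgType := SGraph {
  edges :> {set {set V}};
  _ : [forall e in edges, #|e| == 2%N]
}.

HB.instance Definition _ (V : finType) := [isSub for @edges V].
HB.instance Definition _ (V : finType) := [Finite of sgraph V by <:].

Section Graphs.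
Variable V : finType.
Implicit Type G : sgraph V.

(* Irreflexive, because [set x; x] is not a 2-subset. *)
Definition adj G : rel V := fun x y => [set x; y]%SET \in edges G.

Definition components G : {set {set V}} :=
  equivalence_partition (connect (adj G)) [set: V]%SET.

Definition connected_graph G : Prop :=
  (0 < #|V|)%N /\ forall x y : V, connect (adj G) x y.

Lemma induced_subgraph_subproof G (C : {set V}) :
  [forall e in [set e : {set {x : V | x \in C}}
                 | [set val x | x in e]%SET \in edges G]%SET, #|e| == 2%N].
Proof.
apply/forall_inP => e; rewrite inE => he.
have := forall_inP (valP G) _ he.
by rewrite card_imset //; exact: val_inj.
Qed.

Definition induced_subgraph G (C : {set V}) : sgraph {x : V | x \in C} :=
  SGraph (induced_subgraph_subproof G C).

Definition num_edges G : nat := #|edges G|.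
Definition num_comp G : nat := #|components G|.

End Graphs.

Definition is_iso (V W : finType) (G : sgraph V) (H : sgraph W) (f : V -> W) :
    Prop :=
  bijective f /\ forall x y : V, adj H (f x) (f y) = adj G x y.

Definition isomorphic (V W : finType) (G : sgraph V) (H : sgraph W) : Prop :=
  exists f : V -> W, is_iso G H f.

Definition num_aut (V : finType) (G : sgraph V) : nat :=
  #|[set s : {perm V} | `[< is_iso G G s >]]%SET|.

(* kappa(G, H) *)
Definition num_comp_iso (V W : finType) (G : sgraph V) (H : sgraph W) : nat :=
  #|[set C in components G | `[< isomorphic (induced_subgraph G C) H >]]%SET|.

Lemma isomorphic_refl (V : finType) (G : sgraph V) : isomorphic G G.
Proof. by exists id; split => //; exists id. Qed.

Lemma isomorphic_sym (V W : finType) (G : sgraph V) (H : sgraph W) :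
  isomorphic G H -> isomorphic H G.
Proof.
move=> [f [[g fK gK] fadj]]; exists g; split; first by exists f.
by move=> x y; rewrite -fadj !gK.
Qed.

Lemma isomorphic_trans (U V W : finType) (F : sgraph U) (G : sgraph V)
    (H : sgraph W) :
  isomorphic F G -> isomorphic G H -> isomorphic F H.
Proof.
move=> [f [fbij fadj]] [g [gbij gadj]]; exists (g \o f).
by split; [exact: bij_comp | move=> x y /=; rewrite gadj fadj].
Qed.

Definition lgraph : Type := {n : nat & sgraph 'I_n}.

Definition lgraph_iso : rel lgraph :=
  fun G H => `[< isomorphic (tagged G) (tagged H) >].

Lemma lgraph_iso_refl : reflexive lgraph_iso.
Proof. by move=> G; apply/asboolP; exact: isomorphic_refl. Qed.

Lemma lgraph_iso_sym : symmetric lgraph_iso.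
Proof.
by move=> G H; apply/asboolP/asboolP; exact: isomorphic_sym.
Qed.

Lemma lgraph_iso_trans : transitive lgraph_iso.
Proof.
move=> G F H /asboolP FG /asboolP GH.
by apply/asboolP; exact: isomorphic_trans GH.
Qed.

Canonical lgraph_iso_equiv :=
  EquivRel lgraph_iso lgraph_iso_refl lgraph_iso_sym lgraph_iso_trans.

(* Unlabelled graphs: isomorphism classes of finite graphs. *)
Definition ugraph : Type := {eq_quot lgraph_iso}.
HB.instance Definition _ := Countable.on ugraph.

Lemma edgeless_subproof (V : finType) :
  [forall e in (finset.set0 : {set {set V}}), #|e| == 2%N].
Proof. by apply/forall_inP => e; rewrite inE. Qed.

Definition edgeless (V : finType) : sgraph V := SGraph (edgeless_subproof V).

HB.instance Definition _ := isPointed.Build ugraph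
  (\pi_ugraph (existT (fun n => sgraph 'I_n) 0%N (edgeless 'I_0))).
HB.instance Definition _ := @isMeasurable.Build default_measure_display
  ugraph discrete_measurable discrete_measurable0
  discrete_measurableC discrete_measurableU.

(* Isomorphism-invariant parameters, computed on the chosen representative. *)
Definition urepr (H : ugraph) : sgraph 'I_(tag (repr H)) := tagged (repr H).
Definition uverts (H : ugraph) : nat := tag (repr H).
Definition uedges (H : ugraph) : nat := num_edges (urepr H).
Definition ucomps (H : ugraph) : nat := num_comp (urepr H).
Definition uaut (H : ugraph) : nat := num_aut (urepr H).

(* [ucomp_iso H G] is kappa(G, H). *)
Definition ucomp_iso (H G : ugraph) : nat :=
  num_comp_iso (urepr G) (urepr H).

Lemma ucomp_iso_measurable (H : ugraph) :
  measurable_fun [set: ugraph] (ucomp_iso H).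
Proof. by []. Qed.

HB.instance Definition _ (H : ugraph) :=
  isMeasurableFun.Build _ _ ugraph nat (ucomp_iso H) (ucomp_iso_measurable H).

Definition graph_family := forall V : finType, set (sgraph V).

Definition iso_closed (A : graph_family) : Prop :=
  forall (V W : finType) (G : sgraph V) (H : sgraph W),
    isomorphic G H -> A V G -> A W H.

(* The empty graph has no components, so it lies in every decomposable class. *)
Definition decomposable (A : graph_family) : Prop :=
  forall (V : finType) (G : sgraph V),
    A V G <-> (forall C : {set V}, C \in components G -> A _ (induced_subgraph G C)).

Definition connected_members (A : graph_family) : graph_family :=
  fun V => [set G | A V G /\ connected_graph G].

Definition unlabelled (A : graph_family) : set ugraph :=
  [set \pi_ugraph G | G in [set G : lgraph | A _ (tagged G)]].

Section Weights.
Context {R : realType}.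
Implicit Types (x rho lambda nu : R) (A : graph_family).

Definition egf A x lambda nu : \bar R :=
  (\sum_(0 <= n <oo) (\sum_(G : sgraph 'I_n | G \in A 'I_n)
     x ^+ n / n`!%:R * lambda ^+ num_edges G * nu ^+ num_comp G)%:E)%E.

Definition mu rho lambda nu (H : ugraph) : R :=
  rho ^+ uverts H * lambda ^+ uedges H * nu ^+ ucomps H / (uaut H)%:R.

(* Mutual independence of the family (X i) for i in D. *)
Definition mutually_independent (I : choiceType) d d' (T : measurableType d)
    (T' : measurableType d') (P : probability T R) (D : set I)
    (X : I -> {mfun T >-> T'}) : Prop :=
  forall (J : {fset I}) (B : I -> set T'),
    [set` J] `<=` D -> (forall i, measurable (B i)) ->
    P (\bigcap_(i in [set` J]) X i @^-1` B i) =
      (\prod_(i <- J) P (X i @^-1` B i))%E.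

(* The Poisson distribution; the last argument of [poisson_prob] is unused.
   For [rate <= 0] this is the Dirac mass at 0. *)
Definition Po (rate : R) : set nat -> \bar R := poisson_prob rate 0.

End Weights.

(* Main.v *)
Require Import Defs.
From HB Require Import structures.
From mathcomp Require Import all_boot all_order all_algebra all_fingroup finmap.
From mathcomp Require Import all_classical all_reals all_analysis.
From mathcomp Require Import generic_quotient ring.

Set Implicit Arguments.
Unset Strict Implicit.
Unset Printing Implicit Defensive.

Import Order.TTheory GRing.Theory Num.Theory.
Import numFieldNormedType.Exports.

(* By orbit-stabiliser, an unlabelled graph H on n vertices has n!/aut(H)
   labellings, so for every isomorphism-closed class F the sum of mu over the
   unlabelled graphs of F is the generating function of F at rho.

   Fix a connected H in A and a class F for which deleting a component
   isomorphic to H neither creates nor destroys membership. Let F_k be the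
   class of graphs in F with exactly k components isomorphic to H. Double
   counting the labelled pairs (G, C), with G in F_(k+1) and C a component of G
   isomorphic to H, gives (k+1) F_(k+1)(rho) = mu(H) F_k(rho). Hence the
   numbers F_k(rho) are proportional to the Poisson weights mu(H)^k / k!, and
   the graphs in F with kappa(G, H) in B have total weight
   Po(mu(H))(B) F(rho). Applying this to the classes F obtained from A by
   constraining the numbers of components of other types, one type at a time,
   gives both independence and the marginal distributions. No formula for the
   automorphism group of a disconnected graph is needed. *)

Local Open Scope ring_scope.

(** * Components, induced subgraphs and isomorphisms *)

Section Adjacency.
Variable V : finType.
Implicit Types (G H : sgraph V) (C K : {set V}).

Lemma adjC G x y : adj G x y = adj G y x.
Proof. by rewrite /adj finset.setUC. Qed.

Lemma sgraph_ext G H : adj G =2 adj H -> G = H.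
Proof.
move=> eGH; apply: val_inj; apply/setP => e.
have [] := boolP (#|e| == 2%N).
  by case/cards2P => x [y [_ ->]]; exact: eGH.
move=> ne; have hG := forall_inP (valP G) e; have hH := forall_inP (valP H) e.
by apply/idP/idP => [/hG|/hH] /= => /eqP e2; rewrite e2 eqxx in ne.
Qed.

Lemma connect_adj_sym G : connect_sym (adj G).
Proof. by apply: sym_connect_sym => x y; exact: adjC. Qed.

Lemma componentsP G C :
  reflect (exists x, C = [set y | connect (adj G) x y]%SET)
          (C \in components G).
Proof.
apply: (iffP imsetP) => [[x _ ->]|[x ->]]; exists x => //;
  by apply/setP => y; rewrite !inE.
Qed.

Lemma components_neq0 G C : C \in components G -> C != finset.set0.
Proof.
by case/componentsP => x ->; apply/set0Pn; exists x; rewrite inE connect0.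
Qed.

Lemma adj_induced G C (x y : {x | x \in C}) :
  adj (induced_subgraph G C) x y = adj G (val x) (val y).
Proof. by rewrite /adj inE finset.imsetU !finset.imset_set1. Qed.

(** Equivalently, C is a union of components. Unlike being a component, this passes to the
    complement, so the same lemmas serve for a component and for the rest of the graph. *)
Definition split_at G C : bool :=
  [forall x, forall y, adj G x y ==> ((x \in C) == (y \in C))].

Lemma split_atP G C :
  reflect (forall x y, adj G x y -> (x \in C) = (y \in C)) (split_at G C).
Proof.
by apply: (iffP 'forall_forallP) => h x y;
  [move/(implyP (h x y))/eqP | apply/implyP => /h/eqP].
Qed.

Lemma split_atC G C : split_at G (~: C)%SET = split_at G C.
Proof.
by apply: eq_forallb => x; apply: eq_forallb => y;
  rewrite !inE (inj_eq negb_inj).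
Qed.

Lemma split_at_connect G C x y :
  split_at G C -> connect (adj G) x y -> (x \in C) = (y \in C).
Proof.
move=> /split_atP GC /connectP[p + ->].
by elim: p x => //= z p IH x /andP[/GC -> /IH].
Qed.

Lemma component_split_at G C : C \in components G -> split_at G C.
Proof.
case/componentsP => x ->; apply/split_atP => y z yz; rewrite !inE.
apply/idP/idP => h; apply: connect_trans h (connect1 _) => //.
by rewrite adjC.
Qed.

(** No edge leaves C, so a path of G that starts in C stays there and lifts to the subtype vertex by
    vertex. *)
Lemma connect_induced G C (x y : {x | x \in C}) : split_at G C ->
  connect (adj (induced_subgraph G C)) x y = connect (adj G) (val x) (val y).
Proof.
move=> GC; apply/idP/idP => /connectP[p].
  elim: p x => [x _ ->|z p IH x] /=; first exact: connect0.
  rewrite adj_induced => /andP[xz zp] yE.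
  exact: connect_trans (connect1 xz) (IH _ zp yE).
elim: p x => [x _ /val_inj ->|z p IH x] /=; first exact: connect0.
move=> /andP[xz zp] yE.
have zC : z \in C by rewrite -(split_atP _ _ GC _ _ xz); exact: valP.
apply: connect_trans (IH (Sub z zC) zp yE).
by apply: connect1; rewrite adj_induced.
Qed.

End Adjacency.

Section Components.
Variable V : finType.
Implicit Types (G : sgraph V) (C K : {set V}).

Lemma component_induced G C (K : {set {x | x \in C}}) : split_at G C ->
  ((val @: K)%SET \in components G) = (K \in components (induced_subgraph G C)).
Proof.
move=> GC; apply/componentsP/componentsP => [[x xE]|[x ->]].
  have xK : x \in (val @: K)%SET by rewrite xE inE connect0.
  case/imsetP: xK => x' _ xx'; exists x'; apply/setP => y.
  by rewrite inE connect_induced// -xx' -(mem_imset _ _ val_inj) xE inE.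
exists (val x); apply/setP => y; rewrite inE.
apply/imsetP/idP => [[y' + ->]|xy]; first by rewrite inE connect_induced.
have yC : y \in C by rewrite -(split_at_connect GC xy); exact: valP.
by exists (Sub y yC) => //; rewrite inE connect_induced.
Qed.

Lemma component_imset_induced G C K : split_at G C -> K \in components G ->
  (exists2 x, x \in K & x \in C) ->
  exists2 K', K' \in components (induced_subgraph G C) & K = (val @: K')%SET.
Proof.
move=> GC KG [x xK xC].
have KC : {subset K <= C}.
  move=> y; move/componentsP: (KG) xK => [z ->]; rewrite !inE => zx zy.
  by rewrite -(split_at_connect GC zy) (split_at_connect GC zx).
have KE : K = (val @: [set y : {x | x \in C} | val y \in K])%SET.
  apply/setP => y; apply/idP/imsetP => [yK|[y' + ->]]; last by rewrite inE.
  by exists (Sub y (KC _ yK)) => //; rewrite inE.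
exists [set y : {x | x \in C} | val y \in K]%SET => //.
by rewrite -component_induced// -KE.
Qed.

(** The first condition concerns only the edges between C and its complement, the second only the
    graph on C. In the double count this lets the graph on C and the graph on the complement be
    chosen independently. *)
Lemma in_componentsE G C :
  (C \in components G) <->
  split_at G C /\ connected_graph (induced_subgraph G C).
Proof.
split=> [CG|[GC [C0 Cc]]].
  have GC := component_split_at CG; split => //; split.
    by rewrite card_sig card_gt0; exact: components_neq0 CG.
  move=> x y; rewrite connect_induced//; have [z CE] := componentsP _ _ CG.
  have zC u : u \in C -> connect (adj G) z u by rewrite CE inE.
  have := zC _ (valP x); rewrite connect_adj_sym => /connect_trans; apply.
  exact: zC (valP y).
move/card_gt0P: C0 => [x _]; apply/componentsP; exists (val x).
apply/setP => y; rewrite inE; apply/idP/idP => [yC|/(split_at_connect GC) <-].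
  by have := Cc x (Sub y yC); rewrite connect_induced.
exact: valP.
Qed.

(** A component that meets C lies inside C, so sorting the components by whether they meet C puts
    each of them on exactly one side. The predicate [p] lets one proof count all components as well
    as those of a given type. *)
Lemma card_components_split G C (p : pred {set V}) : split_at G C ->
  #|[set K in components G | p K]%SET| =
  (#|[set K in components (induced_subgraph G C) | p (val @: K)%SET]%SET| +
   #|[set K in components (induced_subgraph G (~: C))
       | p (val @: K)%SET]%SET|)%N.
Proof.
move=> GC; have GC' : split_at G (~: C)%SET by rewrite split_atC.
rewrite -(finset.cardsID [set K : {set V} | [exists x in K, x \in C]]%SET).
congr addn.
- rewrite -(card_imset _ (imset_inj val_inj)); apply: eq_card => K.
  apply/idP/imsetP => [|[K' + ->]]; rewrite !inE.
    move=> /andP[/andP[KG pK] /exists_inP /(component_imset_induced GC KG)].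
    by case=> K' K'G KE; exists K'; rewrite // inE K'G -KE.
  move=> /andP[K'G pK']; rewrite component_induced// K'G pK' /=.
  have /set0Pn[x xK'] := components_neq0 K'G.
  by apply/exists_inP; exists (val x); [exact: imset_f|exact: valP].
- rewrite -(card_imset _ (imset_inj val_inj)); apply: eq_card => K.
  apply/idP/imsetP => [|[K' + ->]]; rewrite !inE.
    move=> /andP[/exists_inPn KC /andP[KG pK]].
    have /set0Pn[x xK] := components_neq0 KG.
    have xC : exists2 x, x \in K & x \in (~: C)%SET.
      by exists x; rewrite // inE KC.
    have [K' K'G KE] := component_imset_induced GC' KG xC.
    by exists K'; rewrite // inE K'G -KE.
  move=> /andP[K'G pK']; rewrite component_induced// K'G pK' /= andbT.
  apply/exists_inPn => _ /imsetP[x _ ->].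
  by have := valP x; rewrite inE.
Qed.

End Components.

Lemma induced_induced (V : finType) (G : sgraph V) (C : {set V})
    (K : {set {x | x \in C}}) :
  isomorphic (induced_subgraph (induced_subgraph G C) K)
             (induced_subgraph G (val @: K)%SET).
Proof.
pose f (x : {y : {x | x \in C} | y \in K}) : {x | x \in (val @: K)%SET} :=
  Sub (val (val x)) (imset_f val (valP x)).
exists f; split; last by move=> x y; rewrite !adj_induced.
apply: inj_card_bij; first by move=> x y /(congr1 val) /= /val_inj /val_inj.
by rewrite !card_sig card_imset//; exact: val_inj.
Qed.

Section Isomorphism.
Variables (V W : finType).
Implicit Types (G : sgraph V) (H : sgraph W).

Lemma isomorphic_card G H : isomorphic G H -> #|V| = #|W|.
Proof. by case=> f [/bij_eq_card]. Qed.

Lemma relabel_subproof (f : V -> W) (f_inj : injective f) G :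
  [forall e in [set f @: e | e : {set V} in edges G]%SET, #|e| == 2%N].
Proof.
apply/forall_inP => _ /imsetP[e /(forall_inP (valP G)) he ->].
by rewrite card_imset.
Qed.

(** Asking only for injectivity covers both the transport along a bijection and the inclusion [val]
    of a vertex subset, which makes the other vertices isolated. *)
Definition relabel (f : V -> W) (f_inj : injective f) G : sgraph W :=
  SGraph (relabel_subproof f_inj G).

Lemma adj_relabel f (f_inj : injective f) G x y :
  adj (relabel f_inj G) (f x) (f y) = adj G x y.
Proof.
rewrite /adj /= -!finset.imset_set1 -finset.imsetU mem_imset//.
exact: imset_inj.
Qed.

Lemma relabel_iso f (f_inj : injective f) G : bijective f ->
  is_iso G (relabel f_inj G) f.
Proof. by move=> bf; split => // x y; rewrite adj_relabel. Qed.

Lemma iso_relabel f (f_inj : injective f) G H : is_iso G H f ->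
  H = relabel f_inj G.
Proof.
move=> [[g fK gK] fG]; apply: sgraph_ext => x y.
by rewrite -(gK x) -(gK y) adj_relabel fG.
Qed.

Lemma connect_iso f G H x y : is_iso G H f ->
  connect (adj H) (f x) (f y) = connect (adj G) x y.
Proof.
move=> [[g fK gK] fG]; apply/idP/idP => /connectP[p].
  elim: p x => [x _ /(can_inj fK) ->|z p IH x] /=; first exact: connect0.
  rewrite -[z]gK fG => /andP[xz zp] yE.
  by apply: connect_trans (connect1 xz) (IH _ zp yE).
elim: p x => [x _ ->|z p IH x] /=; first exact: connect0.
move=> /andP[xz zp] yE.
by apply: connect_trans (IH _ zp yE); apply: connect1; rewrite fG.
Qed.

Lemma num_edges_iso G H : isomorphic G H -> num_edges G = num_edges H.
Proof.
case=> f fiso; have f_inj := bij_inj fiso.1.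
rewrite (iso_relabel f_inj fiso) /num_edges /= card_imset//.
exact: imset_inj.
Qed.

Lemma components_iso f G H : is_iso G H f ->
  components H = [set f @: C | C : {set V} in components G]%SET.
Proof.
move=> fiso; have [[g fK gK] _] := fiso.
have fE x : [set y | connect (adj H) (f x) y]%SET =
    (f @: [set y | connect (adj G) x y])%SET.
  apply/setP => y; rewrite -(gK y) (mem_imset _ _ (can_inj fK)) !inE.
  exact: connect_iso.
apply/setP => C; apply/componentsP/imsetP => [[x ->]|[K /componentsP[x ->] ->]].
  exists [set y | connect (adj G) (g x) y]%SET; last by rewrite -fE gK.
  by apply/componentsP; exists (g x).
by exists (f x); rewrite fE.
Qed.

Lemma card_components_iso f G H (p : pred {set V}) (q : pred {set W}) :
  is_iso G H f -> (forall C : {set V}, q (f @: C)%SET = p C) ->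
  #|[set C in components H | q C]%SET| = #|[set C in components G | p C]%SET|.
Proof.
move=> fiso pq; have f_inj := imset_inj (bij_inj fiso.1).
rewrite -(card_imset _ f_inj); apply: eq_card => C.
rewrite (components_iso fiso); apply/idP/imsetP => [|[K + ->]]; rewrite !inE.
  by case/andP => /imsetP[K KG ->] qK; exists K; rewrite // inE KG -pq.
by case/andP => KG pK; rewrite mem_imset// KG pq.
Qed.

Lemma num_comp_isomorphic G H : isomorphic G H -> num_comp G = num_comp H.
Proof.
case=> f fiso; have := card_components_iso (p := xpredT) (q := xpredT) fiso.
move=> /(_ (fun=> erefl)); rewrite /num_comp => h; symmetry.
by apply: etrans (etrans _ h) _; apply: eq_card => x; rewrite inE andbT.
Qed.

Lemma induced_iso f G H (C : {set V}) : is_iso G H f ->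
  isomorphic (induced_subgraph G C) (induced_subgraph H (f @: C)%SET).
Proof.
case=> fbij fG; have f_inj := bij_inj fbij.
exists (fun x : {x | x \in C} =>
  Sub (f (val x)) (imset_f f (valP x)) : {x | x \in (f @: C)%SET}).
split; last by move=> x y; rewrite !adj_induced fG.
apply: inj_card_bij; first by move=> x y /(congr1 val) /= /f_inj /val_inj.
by rewrite !card_sig card_imset.
Qed.

Lemma isomorphic_asbool (U : finType) (K : sgraph U) G H :
  isomorphic G H -> `[< isomorphic G K >] = `[< isomorphic H K >].
Proof.
move=> GH; apply/asboolP/asboolP; last exact: isomorphic_trans.
exact/isomorphic_trans/isomorphic_sym.
Qed.

End Isomorphism.

Lemma num_comp_iso_isomorphic (V W U : finType) (G : sgraph V) (H : sgraph W)
    (K : sgraph U) :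
  isomorphic G H -> num_comp_iso G K = num_comp_iso H K.
Proof.
case=> f fiso; symmetry; apply: card_components_iso (fiso) _ => C.
exact/esym/isomorphic_asbool/induced_iso.
Qed.

(** * Additivity of the graph parameters over a split vertex set *)

Section Split.
Variables (V : finType) (G : sgraph V) (C : {set V}).
Hypothesis GC : split_at G C.

Lemma num_comp_split :
  num_comp G = (num_comp (induced_subgraph G C)
              + num_comp (induced_subgraph G (~: C)))%N.
Proof.
have compE (W : finType) (H : sgraph W) :
    num_comp H = #|[set K in components H | xpredT K]%SET|.
  by apply: eq_card => x; rewrite inE andbT.
by rewrite !compE; exact: card_components_split.
Qed.

Lemma num_comp_iso_split (W : finType) (H : sgraph W) :
  num_comp_iso G H = (num_comp_iso (induced_subgraph G C) H
              + num_comp_iso (induced_subgraph G (~: C)) H)%N.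
Proof.
rewrite /num_comp_iso (card_components_split _ GC); congr (_ + _)%N;
  by apply: eq_card => K;
    rewrite !inE (isomorphic_asbool _ (induced_induced G _)).
Qed.

Lemma num_edges_split :
  num_edges G = (num_edges (induced_subgraph G C)
              + num_edges (induced_subgraph G (~: C)))%N.
Proof.
rewrite /num_edges.
rewrite -(finset.cardsID [set e : {set V} | e \subset C]%SET (edges G)).
congr addn.
- rewrite -(card_imset _ (imset_inj val_inj)); apply: eq_card => e.
  apply/idP/imsetP => [|[e' + ->]]; rewrite !inE.
    case/andP => eG /fintype.subsetP eC.
    have eE : e = (val @: [set y : {x | x \in C} | val y \in e])%SET.
      apply/setP => y; apply/idP/imsetP => [ye|[y' + ->]]; last by rewrite inE.
      by exists (Sub y (eC _ ye)) => //; rewrite inE.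
    by exists [set y : {x | x \in C} | val y \in e]%SET => //; rewrite inE -eE.
  move=> -> /=; apply/fintype.subsetP => _ /imsetP[x _ ->]; exact: valP.
- rewrite -(card_imset _ (imset_inj val_inj)); apply: eq_card => e.
  apply/idP/imsetP => [|[e' + ->]]; rewrite !inE.
    case/andP => eC eG.
    have eC' : {subset e <= (~: C)%SET}.
      (* An edge not contained in C has an endpoint outside C, and the split then forces the other
         endpoint outside as well. *)
      have /cards2P[x [y [_ eE]]] := forall_inP (valP G) _ eG.
      rewrite eE /= in eG eC *; have xyC := split_atP _ _ GC _ _ eG.
      have xC : x \notin C.
        apply: contra eC => xC; apply/fintype.subsetP => z.
        by rewrite !inE => /orP[] /eqP ->; rewrite -?xyC.
      by move=> z; rewrite !inE => /orP[] /eqP ->; rewrite -?xyC.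
    have eE : e = (val @: [set y : {x | x \in (~: C)%SET} | val y \in e])%SET.
      apply/setP => y; apply/idP/imsetP => [ye|[y' + ->]]; last by rewrite inE.
      by exists (Sub y (eC' _ ye)) => //; rewrite inE.
    by exists [set y : {x | x \in (~: C)%SET} | val y \in e]%SET => //;
      rewrite inE -eE.
  move=> e'G; rewrite e'G andbT; apply/negP => /fintype.subsetP e'C.
  (* Edges are non-empty, so none lies both in C and in its complement. *)
  have /card_gt0P[x xe'] : (0 < #|e'|)%N.
    have := forall_inP (valP G) _ e'G.
    by rewrite card_imset => [/eqP ->|]; last exact: val_inj.
  have := e'C _ (imset_f val xe'); have := valP x; by rewrite inE => /negPf ->.
Qed.

End Split.

(** * Counting labelled graphs *)

Section ConnectedGraph.
Variables (V : finType) (G : sgraph V).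

Lemma induced_setT : isomorphic (induced_subgraph G finset.setT) G.
Proof.
exists val; split; last by move=> x y; rewrite adj_induced.
apply: inj_card_bij; first exact: val_inj.
by rewrite card_sig cardsT.
Qed.

Hypothesis G_conn : connected_graph G.

Lemma components_connected : components G = [set finset.setT]%SET.
Proof.
have compT x : [set y | connect (adj G) x y]%SET = finset.setT.
  by apply/setP => y; rewrite !inE G_conn.2.
apply/setP => C; rewrite !inE; apply/componentsP/eqP => [[x ->] //|->].
by case/card_gt0P: G_conn.1 => x _; exists x.
Qed.

Lemma num_comp_iso_connected (W : finType) (H : sgraph W) :
  num_comp_iso G H = `[< isomorphic G H >].
Proof.
rewrite /num_comp_iso components_connected -(isomorphic_asbool _ induced_setT).
case: asboolP => GH.
  by apply/eqP/cards1P; exists finset.setT; apply/setP => C; rewrite !inE;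
    case: eqP => //= ->; apply/asboolP.
by apply/eqP; rewrite cards_eq0; apply/eqP/setP => C; rewrite !inE;
  case: eqP => //= ->; apply/asboolP.
Qed.

End ConnectedGraph.

Lemma connected_isomorphic (V W : finType) (G : sgraph V) (H : sgraph W) :
  isomorphic G H -> connected_graph G -> connected_graph H.
Proof.
move=> GH [V0 Gc]; split; first by rewrite -(isomorphic_card GH).
have [f fiso] := GH; have [[g fK gK] _] := fiso.
by move=> x y; rewrite -(gK x) -(gK y) (connect_iso _ _ fiso).
Qed.

(** Relabelling along any bijection of V with W is a bijection between the graphs on V and those on
    W. The bijection used here matches enumeration ranks. *)
Lemma sum_sgraph_card (M : nmodType) (V W : finType) (phi : sgraph V -> M)
    (psi : sgraph W -> M) :
  #|V| = #|W| -> (forall G H, isomorphic G H -> phi G = psi H) ->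
  \sum_G phi G = \sum_H psi H.
Proof.
move=> VW phipsi.
pose f x := enum_val (cast_ord VW (enum_rank x)).
pose g x := enum_val (cast_ord (esym VW) (enum_rank x)).
have fK : cancel f g by move=> x; rewrite /f /g enum_valK cast_ordK enum_rankK.
have gK : cancel g f by move=> x; rewrite /f /g enum_valK cast_ordKV enum_rankK.
have f_inj := can_inj fK; have g_inj := can_inj gK.
have [fbij gbij] : bijective f /\ bijective g by split; [exists g | exists f].
rewrite [RHS](reindex (relabel f_inj)) /=.
  by apply: eq_bigr => G _; apply: phipsi; exists f; exact: relabel_iso.
apply: onW_bij; exists (relabel g_inj) => G; apply: sgraph_ext => x y.
  by rewrite -(fK x) -(fK y) !adj_relabel !fK.
by rewrite -(gK x) -(gK y) !adj_relabel !gK.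
Qed.

(* Orbit-stabiliser for the symmetric group of [V] acting on graphs. *)
Lemma card_isomorphic (V : finType) (H : sgraph V) :
  (#|[set G : sgraph V | `[< isomorphic G H >]]%SET| * num_aut H = (#|V|)`!)%N.
Proof.
have -> : ((#|V|)`! = #|{perm V}|)%N.
  rewrite -(cardsT V) -card_perm; apply: eq_card => s.
  by rewrite !inE; apply/fintype.subsetP => x _; rewrite inE.
pose rl (s : {perm V}) := relabel (@perm_inj _ s) H.
have rl_iso s : isomorphic (rl s) H.
  apply: isomorphic_sym; exists s; apply: relabel_iso.
  by exists (s^-1)%g; [exact: permK | exact: permKV].
(* Permutations are grouped by the image of H under them; every group turns out to have [num_aut H]
   elements. *)
rewrite -[#|{perm V}|]sum1_card
  (partition_big rl (fun G => `[< isomorphic G H >])) /=; last first.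
  by move=> s _; apply/asboolP.
rewrite -sum_nat_const.
rewrite [LHS](eq_bigl (fun G => `[< isomorphic G H >])); last first.
  by move=> G; rewrite inE.
apply: eq_bigr => G /asboolP/isomorphic_sym[f fiso].
rewrite sum1_card; pose t := perm (bij_inj fiso.1).
have -> : G = rl t.
  apply: iso_relabel; split.
    by exists (t^-1)%g; [exact: permK | exact: permKV].
  by move=> x y; rewrite !permE fiso.2.
(* The permutations carrying H to G form the coset of products [a * t]: first an automorphism [a] of
   H, then the fixed isomorphism [t]. *)
rewrite -[LHS](card_imset _ (mulIg t)); apply: eq_card => s.
transitivity (rl s == rl t) => //; apply/imsetP/eqP => [[a + ->]|st].
  rewrite inE => /asboolP[_ aH]; apply: sgraph_ext => x y.
  rewrite -(permKV (a * t)%g x) -(permKV (a * t)%g y) adj_relabel !permM.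
  by rewrite adj_relabel aH.
exists (s * t^-1)%g; last by rewrite mulgKV.
rewrite inE; apply/asboolP; split.
  by exists ((s * t^-1)^-1)%g; [exact: permK | exact: permKV].
move=> x y; rewrite -(adj_relabel (@perm_inj _ t)) -/(rl t) -st !permM !permKV.
exact: adj_relabel.
Qed.

(** * Graphs split at C as pairs of graphs on C and its complement *)

Section Glue.
Variables (V : finType) (C : {set V}).
Implicit Types (L : sgraph {x | x \in C}) (K : sgraph {x | x \in (~: C)%SET}).

Lemma glue_subproof L K :
  [forall e in (edges (relabel val_inj L) :|: edges (relabel val_inj K))%SET,
    #|e| == 2%N].
Proof.
apply/forall_inP => e /finset.setUP[].
  exact: (forall_inP (valP (relabel val_inj L))).
exact: (forall_inP (valP (relabel val_inj K))).
Qed.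

Definition glue L K : sgraph V := SGraph (glue_subproof L K).

Lemma adj_glue L K x y : adj (glue L K) x y =
  adj (relabel val_inj L) x y || adj (relabel val_inj K) x y.
Proof. by rewrite /adj inE. Qed.

Lemma adj_relabel_val (D : {set V}) (G : sgraph {x | x \in D}) x y :
  adj (relabel val_inj G) x y -> (x \in D) && (y \in D).
Proof.
move=> /imsetP[e _ xyE].
have eD z : z \in [set x; y]%SET -> z \in D.
  by rewrite xyE => /imsetP[z' _ ->]; exact: valP.
by rewrite !eD // !inE eqxx ?orbT.
Qed.

Lemma glue_split L K : split_at (glue L K) C.
Proof.
apply/split_atP => x y; rewrite adj_glue => /orP[] /adj_relabel_val.
  by case/andP => -> ->.
by rewrite !inE => /andP[/negPf -> /negPf ->].
Qed.

Lemma induced_glue_l L K : induced_subgraph (glue L K) C = L.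
Proof.
apply: sgraph_ext => x y; rewrite adj_induced adj_glue adj_relabel.
apply/orb_idr => /adj_relabel_val/andP[].
by rewrite inE; have -> := valP x.
Qed.

Lemma induced_glue_r L K : induced_subgraph (glue L K) (~: C) = K.
Proof.
apply: sgraph_ext => x y; rewrite adj_induced adj_glue adj_relabel.
apply/orb_idl => /adj_relabel_val/andP[+ _].
by have := valP x; rewrite inE => /negPf ->.
Qed.

Lemma glue_induced G : split_at G C ->
  glue (induced_subgraph G C) (induced_subgraph G (~: C)) = G.
Proof.
move=> GC; apply: sgraph_ext => x y; rewrite adj_glue.
have adjE (D : {set V}) (xD : x \in D) (yD : y \in D) :
    adj (relabel val_inj (induced_subgraph G D)) x y = adj G x y.
  have -> : x = val (Sub x xD : {x | x \in D}) by [].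
  have -> : y = val (Sub y yD : {x | x \in D}) by [].
  by rewrite adj_relabel adj_induced.
apply/orP/idP => [|xy].
  by case=> xy; have /andP[xD yD] := adj_relabel_val xy; rewrite adjE in xy.
have := split_atP _ _ GC _ _ xy.
have [xC yC|xC /esym/negbT yC] := boolP (x \in C).
  by left; rewrite adjE.
by right; rewrite adjE // inE.
Qed.

(** Restriction to the two sides is a bijection from the graphs split at C onto all pairs, with
    inverse [glue]. *)
Lemma sum_split (R : pzSemiRingType) (phi1 : sgraph {x | x \in C} -> R)
    (phi2 : sgraph {x | x \in (~: C)%SET} -> R) :
  \sum_(G | split_at G C)
      phi1 (induced_subgraph G C) * phi2 (induced_subgraph G (~: C)) =
  (\sum_G phi1 G) * (\sum_G phi2 G).
Proof.
rewrite big_distrlr pair_big /=.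
rewrite (reindex_onto (fun p => glue p.1 p.2)
  (fun G => (induced_subgraph G C, induced_subgraph G (~: C)))) /=; last first.
  by move=> G; exact: glue_induced.
apply: eq_big => [[L K]|[L K] _] /=.
  by rewrite glue_split induced_glue_l induced_glue_r eqxx.
by rewrite induced_glue_l induced_glue_r.
Qed.

End Glue.

(** * Weighted sums of labelled graphs and the double count *)

Section Weight.
Variables (R : comNzRingType) (lambda nu : R).

Definition gweight (V : finType) (G : sgraph V) : R :=
  lambda ^+ num_edges G * nu ^+ num_comp G.

Lemma gweight_isomorphic (V W : finType) (G : sgraph V) (H : sgraph W) :
  isomorphic G H -> gweight G = gweight H.
Proof.
by move=> GH; rewrite /gweight (num_edges_iso GH) (num_comp_isomorphic GH).
Qed.

Lemma gweight_split (V : finType) (G : sgraph V) (C : {set V}) :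
  split_at G C ->
  gweight G =
  gweight (induced_subgraph G C) * gweight (induced_subgraph G (~: C)).
Proof.
move=> GC; rewrite /gweight (num_edges_split GC) (num_comp_split GC) !exprD.
by rewrite mulrACA.
Qed.

(** For V of size n and F closed under isomorphism, this is the coefficient of x^n / n! in the
    generating function of F. Allowing any finite type makes it usable on the complement of a
    component. *)
Definition wsum (F : graph_family) (V : finType) : R :=
  \sum_(G : sgraph V | `[< F V G >]) gweight G.

Lemma wsum_card (F : graph_family) (V W : finType) :
  iso_closed F -> #|V| = #|W| -> wsum F V = wsum F W.
Proof.
move=> Fiso VW; rewrite /wsum big_mkcond [RHS]big_mkcond /=.
apply: sum_sgraph_card => // G H GH; rewrite (gweight_isomorphic GH).
suff -> : `[< F V G >] = `[< F W H >] by [].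
apply/asboolP/asboolP; first exact: Fiso.
by apply: Fiso; exact: isomorphic_sym.
Qed.

Definition with_comps (F : graph_family) (W : finType) (H : sgraph W) (k : nat)
    : graph_family :=
  fun V G => F V G /\ num_comp_iso G H = k.

Lemma with_comps_iso_closed (F : graph_family) (W : finType) (H : sgraph W) k :
  iso_closed F -> iso_closed (with_comps F H k).
Proof.
move=> Fiso V V' G G' GG' [FG <-]; split; first exact: Fiso FG.
exact/esym/num_comp_iso_isomorphic.
Qed.

(** Satisfied by a decomposable class containing H, and still satisfied after constraining the
    numbers of components of types other than H. *)
Definition removal_closed (F : graph_family) (W : finType) (H : sgraph W) :
    Prop :=
  forall (V : finType) (G : sgraph V) (C : {set V}), C \in components G ->
  isomorphic (induced_subgraph G C) H ->
  F V G <-> F _ (induced_subgraph G (~: C)).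

(* Both sides count the pairs (G, C) where C is a component of G isomorphic
   to H. *)
Lemma wsum_with_comps (F : graph_family) (V W : finType) (H : sgraph W) k :
  iso_closed F -> connected_graph H -> removal_closed F H ->
  k.+1%:R * wsum (with_comps F H k.+1) V =
  'C(#|V|, #|W|)%:R * (#|[set G : sgraph W | `[< isomorphic G H >]]%SET|%:R
    * gweight H) * wsum (with_comps F H k) 'I_(#|V| - #|W|).
Proof.
move=> Fiso Hconn FH.
pose compsH (G : sgraph V) :=
  [set C in components G | `[< isomorphic (induced_subgraph G C) H >]]%SET.
(* The factor k + 1 becomes a choice of one of the components isomorphic to H. *)
have -> : k.+1%:R * wsum (with_comps F H k.+1) V =
    \sum_(G | `[< with_comps F H k.+1 G >]) \sum_(C in compsH G) gweight G.
  rewrite /wsum big_distrr /=; apply: eq_bigr => G /asboolP[_ Gk].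
  by rewrite big_const iter_addr_0 -/(num_comp_iso G H) Gk mulr_natl.
(* A component isomorphic to H has as many vertices as H, so C ranges over the subsets of that size;
   their number is the binomial coefficient. *)
rewrite (exchange_big_dep (fun C : {set V} => #|C| == #|W|)) /=; last first.
  move=> G C _; rewrite inE => /andP[_ /asboolP/isomorphic_card <-].
  by rewrite card_sig.
(* For fixed C the inner sum factors into copies of H on C and graphs on the complement, with a
   value independent of C. *)
under eq_bigr => C /eqP CW.
  rewrite (_ : \sum_(_ | _) _ =
    #|[set G : sgraph W | `[< isomorphic G H >]]%SET|%:R * gweight H *
    wsum (with_comps F H k) 'I_(#|V| - #|W|)).
  over.
  have -> : #|[set G : sgraph W | `[< isomorphic G H >]]%SET|%:R * gweight H =
      \sum_(G : sgraph W) if `[< isomorphic G H >] then gweight G else 0.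
    rewrite -big_mkcond /= (eq_bigr (fun=> gweight H)); last first.
      by move=> G /asboolP /gweight_isomorphic.
    rewrite big_const iter_addr_0 mulr_natl; congr (_ *+ _).
    by apply: eq_card => G; rewrite inE.
  rewrite -(sum_sgraph_card (phi := fun G : sgraph {x | x \in C} =>
    if `[< isomorphic G H >] then gweight G else 0)); first last.
  - by move=> G G' GG';
    rewrite (isomorphic_asbool _ GG') (gweight_isomorphic GG').
  - by rewrite card_sig.
  rewrite -(@wsum_card _ {x | x \in (~: C)%SET}); first last.
  - by rewrite card_sig card_ord cardsCs finset.setCK CW.
  - exact: with_comps_iso_closed.
  rewrite /wsum [X in _ = _ * X]big_mkcond -sum_split.
  rewrite big_mkcond [RHS]big_mkcond; apply: eq_bigr => G _ /=.
  (* Graphs not split at C contribute to neither side, since a component always splits. *)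
  rewrite inE; case: (boolP (split_at G C)) => [GC|GC]; last first.
    rewrite ifF//; apply: contraNF GC => /andP[_ /andP[+ _]].
    exact: component_split_at.
  case: (asboolP (isomorphic _ H)) => [GH|_]; last by rewrite !andbF mul0r.
  have CG : C \in components G.
    apply/in_componentsE; split => //.
    exact: connected_isomorphic (isomorphic_sym GH) _.
  rewrite CG /= andbT (gweight_split GC).
  suff -> : `[< with_comps F H k.+1 G >] =
      `[< with_comps F H k (induced_subgraph G (~: C)) >].
    by case: ifP => //; rewrite mulr0.
  (* C is connected and isomorphic to H, so it contributes exactly one to the count. *)
  have kE : num_comp_iso G H = (num_comp_iso (induced_subgraph G (~: C)) H).+1.
    rewrite (num_comp_iso_split GC) num_comp_iso_connected; last first.
      by case/in_componentsE: CG.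
    by rewrite (introT (asboolP _) GH).
  apply/asboolP/asboolP => -[FG]; rewrite /with_comps kE => Gk.
    by split; [apply/(FH _ _ _ CG GH) | case: Gk].
  by split; [apply/(FH _ _ _ CG GH) | rewrite Gk].
rewrite big_const iter_addr_0 -[RHS]mulrA [RHS]mulr_natl; congr (_ *+ _).
by rewrite -card_draws; apply: eq_card => C; rewrite inE.
Qed.

End Weight.

(** * Generating functions *)

Local Open Scope classical_set_scope.
Local Open Scope ring_scope.

(** * Sums of non-negative extended reals over arbitrary index sets *)

Section ExtendedSums.
Variable R : realType.

(** Tonelli's theorem for the pairs (f x, x). It is used to group labelled graphs by size, by
    isomorphism class and by number of components. *)
Lemma esum_partition (T I : choiceType) (f : T -> I) (A : set T) (D : set I)
    (a : T -> \bar R) :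
  (forall x, A x -> D (f x)) -> (forall x, A x -> 0 <= a x)%E ->
  (\esum_(x in A) a x =
   \esum_(i in D) \esum_(x in A `&` f @^-1` [set i]) a x)%E.
Proof.
move=> AD a0; rewrite esum_esum; last by move=> i x _ [/a0].
rewrite (@reindex_esum _ _ _ A _ (fun x => (f x, x)))//.
split=> [x Ax /=|x y _ _ []//|[i x] /= [_ [Ax <-]]]; last by exists x.
by split; [exact: AD | split].
Qed.

Lemma esum_finType (T : finType) (A : set T) (a : T -> R) :
  (forall x, 0 <= a x) ->
  (\esum_(x in A) (a x)%:E)%E = (\sum_(x | `[< A x >]) a x)%:E.
Proof.
move=> a0; have AE : A = [set` [pred x | `[< A x >]]].
  by apply/seteqP; split=> x /asboolP.
rewrite {1}AE esum_fset; first last.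
- by move=> x _; rewrite lee_fin.
- exact: finite_finpred.
rewrite -(bigfs _ (index_enum_uniq T)); last first.
  by move=> x _; rewrite mem_index_enum.
by rewrite sumEFin.
Qed.

Lemma esumZl (T : choiceType) (A : set T) (c : R) (a : T -> \bar R) :
  0 <= c -> (forall x, 0 <= a x)%E ->
  (\esum_(x in A) (c%:E * a x) = c%:E * \esum_(x in A) a x)%E.
Proof.
(* This inequality is checked on finite partial sums; the converse is the same inequality for the
   inverse of c, the case c = 0 being treated apart. *)
have half (k : R) (b : T -> \bar R) : 0 <= k -> (forall x, 0 <= b x)%E ->
    (\esum_(x in A) (k%:E * b x) <= k%:E * \esum_(x in A) b x)%E.
  move=> k0 b0; apply: ge_ereal_sup => _ [X [finX XA]] <-.
  rewrite -ge0_mule_fsumr// lee_wpmul2l ?lee_fin//.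
  by apply: ereal_sup_ubound; exists X.
rewrite le_eqVlt => /predU1P[<- _|c0 a0].
  by rewrite mul0e esum1// => x _; rewrite mul0e.
have cK (y : \bar R) : (c^-1%:E * (c%:E * y) = y)%E.
  by rewrite muleA -EFinM mulVf ?gt_eqF// mul1e.
have Kc (y : \bar R) : (c%:E * (c^-1%:E * y) = y)%E.
  by rewrite muleA -EFinM mulfV ?gt_eqF// mul1e.
apply/eqP; rewrite eq_le half ?(ltW c0)//=.
rewrite -[leRHS]Kc lee_wpmul2l ?lee_fin ?(ltW c0)//.
rewrite -[leLHS](eq_esum (fun x _ => cK (a x))) half ?invr_ge0 ?(ltW c0)//.
by move=> x; rewrite mule_ge0 ?lee_fin ?(ltW c0).
Qed.

End ExtendedSums.

(** Countable additivity along the codes given by [pickle]. Each code selects at most one point of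
    U, and codes that select none give empty pieces. *)
Lemma measure_preimage_countable d (T : measurableType d) (R : realType)
    (P : {measure set T -> \bar R}) (I : countType) (f : T -> I) (U : set I) :
  (forall i, measurable (f @^-1` [set i])) ->
  P (f @^-1` U) = (\esum_(i in U) P (f @^-1` [set i]))%E.
Proof.
move=> fm; pose E n := f @^-1` (U `&` choice.pickle @^-1` [set n]).
have UE n : (exists2 i, U i & U `&` choice.pickle @^-1` [set n] = [set i]) \/
    U `&` choice.pickle @^-1` [set n] = set0.
  have [[i [Ui /= <-]]|/forallNP UN] :=
    pselect (exists i, (U `&` choice.pickle @^-1` [set n]) i).
    left; exists i => //; apply/seteqP.
    split=> [j /= [_ /(pcan_inj choice.pickleK)]//|j ->].
    by split.
  by right; apply/seteqP; split => // j /UN.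
have -> : f @^-1` U = \bigcup_n E n.
  apply/seteqP; split=> [t Ut|t [n _ []]//].
  by exists (choice.pickle (f t)).
rewrite measure_bigcup; last 2 first.
- by move=> n _; rewrite /E; have [[i _ ->]|->] := UE n; rewrite ?preimage_set0.
- move=> m n _ _ [t [/= [_ <-] [_ <-]]] //.
rewrite (@esum_partition _ _ _ choice.pickle U setT)//.
rewrite nneseries_esum// set_mem_set; apply: eq_esum => n _; rewrite /E.
have [[i _ ->]|->] := UE n; first by rewrite esum_set1.
by rewrite preimage_set0 measure0 esum_set0.
Qed.

Lemma unlabelledP (F : graph_family) (H : ugraph) : iso_closed F ->
  unlabelled F H <-> F _ (urepr H).
Proof.
move=> Fiso; split=> [[G FG <-]|FH]; last first.
  by exists (repr H) => //; rewrite reprK.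
apply: Fiso FG; apply/asboolP.
by rewrite -[X in is_true X]/(lgraph_iso _ _); apply/eqmodP; rewrite reprK.
Qed.

Lemma uaut_card (H : ugraph) :
  (#|[set G : sgraph 'I_(uverts H) | `[< isomorphic G (urepr H) >]]%SET|
     * uaut H = (uverts H)`!)%N.
Proof. by rewrite card_isomorphic card_ord. Qed.

Lemma uaut_gt0 H : (0 < uaut H)%N.
Proof.
by have := fact_gt0 (uverts H); rewrite -uaut_card muln_gt0 => /andP[].
Qed.

Lemma isomorphic_urepr_inj (H K : ugraph) :
  isomorphic (urepr H) (urepr K) -> H = K.
Proof.
by move=> HK; rewrite -(reprK H) -(reprK K); apply/eqmodP/asboolP.
Qed.

(** * The generating function at rho and its Poisson decomposition *)

Section Egf.
Variables (R : realType) (lambda nu rho : R).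
Hypotheses (lambda_gt0 : 0 < lambda) (nu_gt0 : 0 < nu) (rho_gt0 : 0 < rho).
Implicit Types (F : graph_family) (H : ugraph).

Local Notation egf F := (egf F rho lambda nu).
Local Notation mu := (mu rho lambda nu).

Lemma gweight_ge0 (V : finType) (G : sgraph V) : 0 <= gweight lambda nu G.
Proof. by rewrite mulr_ge0// exprn_ge0// ltW. Qed.

Lemma mu_gt0 H : 0 < mu H.
Proof. by rewrite divr_gt0 ?mulr_gt0 ?exprn_gt0 ?ltr0n ?uaut_gt0. Qed.

Definition egf_term F n : R := rho ^+ n / n`!%:R * wsum lambda nu F 'I_n.

Lemma egf_term_ge0 F n : 0 <= egf_term F n.
Proof.
by rewrite mulr_ge0 ?divr_ge0 ?exprn_ge0 ?(ltW rho_gt0) ?sumr_ge0// => G _;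
  exact: gweight_ge0.
Qed.

Lemma egfE F : egf F = (\sum_(0 <= n <oo) (egf_term F n)%:E)%E.
Proof.
apply: eq_eseriesr => n _; congr (_%:E); rewrite /egf_term /wsum big_distrr /=.
by apply: eq_big => [G|G _]; [apply/idP/asboolP; rewrite inE | rewrite mulrA].
Qed.

(** Including the factor rho^n / n! turns the generating function into a single sum over labelled
    graphs of all sizes. *)
Definition lweight (G : lgraph) : R :=
  rho ^+ tag G / (tag G)`!%:R * gweight lambda nu (tagged G).

Lemma lweight_ge0 G : (0 <= (lweight G)%:E)%E.
Proof.
by rewrite lee_fin mulr_ge0 ?gweight_ge0 ?divr_ge0 ?exprn_ge0 ?(ltW rho_gt0).
Qed.

Lemma esum_tag n (S : set (sgraph 'I_n)) :
  (\esum_(G in [set (Tagged (fun n => sgraph 'I_n) g : lgraph)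
    | g in S]) (lweight G)%:E)%E
   = (rho ^+ n / n`!%:R * \sum_(g | `[< S g >]) gweight lambda nu g)%:E.
Proof.
rewrite esum_image; last by move=> g h _ _ /eqP; rewrite eq_Tagged => /eqP.
rewrite esum_finType; first by rewrite big_distrr.
by move=> g; rewrite -lee_fin lweight_ge0.
Qed.

Lemma egf_esum F :
  egf F = (\esum_(G in [set G : lgraph | F _ (tagged G)]) (lweight G)%:E)%E.
Proof.
rewrite egfE (@esum_partition _ _ _ (@tag _ _) _ setT)//; last first.
  by move=> G _; exact: lweight_ge0.
rewrite nneseries_esumT; last by move=> n; rewrite lee_fin egf_term_ge0.
apply: eq_esum => n _; rewrite -esum_tag; congr esum.
apply/seteqP; split=> [_ [g Fg <-]//|[m g] /= [Fg mn]].
by case: _ / mn in g Fg *; exists g.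
Qed.

Lemma egf_ge0 F : (0 <= egf F)%E.
Proof. by rewrite egf_esum esum_ge0// => G _; exact: lweight_ge0. Qed.

(** The n!/aut(H) labellings of H all have the same weight, and the n! cancels. *)
Lemma egf_unlabelled F : iso_closed F ->
  egf F = (\esum_(H in unlabelled F) (mu H)%:E)%E.
Proof.
move=> Fiso; rewrite egf_esum.
rewrite (@esum_partition _ _ ugraph (\pi_ugraph)%qT _ (unlabelled F)); first last.
- by move=> G _; exact: lweight_ge0.
- by move=> G FG; exists G.
apply: eq_esum => H /(unlabelledP _ Fiso) FH.
transitivity (\esum_(G in [set (Tagged (fun n => sgraph 'I_n) g : lgraph) |
    g in [set g : sgraph 'I_(uverts H) | isomorphic g (urepr H)]])
      (lweight G)%:E)%E.
  congr esum; apply/seteqP; split=> [G [/= FG GH]|_ [g gH <-]].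
    have /asboolP GH' : lgraph_iso G (repr H) by apply/eqmodP; rewrite reprK.
    case: G {FG GH} GH' => n g /= gH.
    have nH : n = uverts H by have := isomorphic_card gH; rewrite !card_ord.
    by case: _ / (esym nH) in g gH *; exists g.
  split; first exact: Fiso (isomorphic_sym gH) FH.
  by rewrite /= -[RHS]reprK; apply/eqmodP/asboolP.
rewrite esum_tag; congr (_%:E).
rewrite (eq_bigr (fun=> gweight lambda nu (urepr H))); last first.
  by move=> G /asboolP; exact: gweight_isomorphic.
rewrite big_const iter_addr_0 /mu /gweight /uedges /ucomps.
rewrite -uaut_card; set N := #|[set G | _]%SET|.
rewrite (_ : #|_| = N); last by apply: eq_card => G; rewrite inE.
have N0 : (0 < N)%N.
  by have := fact_gt0 (uverts H); rewrite -uaut_card muln_gt0 => /andP[].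
rewrite natrM -[X in _ * X = _]mulr_natr.
have := uaut_gt0 H; rewrite -(ltr_nat R).
rewrite -(ltr_nat R) in N0; move: N0.
move: (uaut H)%:R N%:R (rho ^+ _) (lambda ^+ _) (nu ^+ _) => a M r l v M0 a0.
by field; rewrite !gt_eqF.
Qed.

(** The double count relates the coefficient of index n + v(H) on the left to that of index n on the
    right. With N labellings of H and h = v(H), the constants agree because C(n+h, h) N / (n+h)! = 1
    / (n! aut(H)). *)
Lemma egf_with_comps F H k : iso_closed F -> connected_graph (urepr H) ->
  removal_closed F (urepr H) ->
  (k.+1%:R%:E * egf (with_comps F (urepr H) k.+1) =
   (mu H)%:E * egf (with_comps F (urepr H) k))%E.
Proof.
move=> Fiso Hconn FH;
set Fk := with_comps F _ k; set Fk1 := with_comps F _ k.+1.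
(* With fewer vertices than H, the binomial coefficient in the double count is zero. *)
have term_lt n : (n < uverts H)%N -> egf_term Fk1 n = 0.
  move=> nH; apply/eqP; rewrite mulf_eq0 orbC; apply/orP; left.
  have := @wsum_with_comps R lambda nu F 'I_n _ (urepr H) k Fiso Hconn FH.
  rewrite !card_ord bin_small// !mul0r => /eqP.
  by rewrite mulf_eq0 pnatr_eq0.
have term_ge n : k.+1%:R * egf_term Fk1 (n + uverts H)%N = mu H * egf_term Fk n.
  rewrite /egf_term mulrCA wsum_with_comps// !card_ord addnK.
  rewrite [X in _ * (X%:R * _) * _](_ : _ = #|[set G : sgraph 'I_(uverts H)
    | `[< isomorphic G (urepr H) >]]%SET|); last by [].
  set N := #|_|.
  have /(congr1 (fun n => n%:R : R)) := bin_fact (leq_addl n (uverts H)).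
  rewrite addnK -uaut_card !natrM => <-.
  have := uaut_gt0 H; rewrite -(ltr_nat R) => a0.
  have := fact_gt0 n; rewrite -(ltr_nat R) => n0.
  have N0 : 0 < N%:R :> R.
    have := fact_gt0 (uverts H).
    by rewrite -uaut_card muln_gt0 ltr0n => /andP[].
  have b0 : 0 < 'C(n + uverts H, uverts H)%:R :> R.
    by rewrite ltr0n bin_gt0 leq_addl.
  rewrite /mu /gweight /uedges /ucomps exprD; move: (wsum _ _ _ _) a0 n0 N0 b0.
  move: ('C(_, _)%:R) (uaut H)%:R N%:R n`!%:R => c a M f.
  move: (rho ^+ n) (rho ^+ uverts H) (lambda ^+ _) (nu ^+ _).
  move=> r r' l v w a0 f0 M0 c0.
  by field; rewrite !gt_eqF.
have t0 G n : (0 <= (egf_term G n)%:E)%E by rewrite lee_fin egf_term_ge0.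
rewrite !egfE (nneseries_split 0 (uverts H)); last by move=> n _; exact: t0.
rewrite big_nat big1 ?add0e; last by move=> n /andP[_ /term_lt ->].
rewrite -nneseries_addn; last by move=> n; exact: t0.
rewrite -!nneseriesZl//; apply: eq_eseriesr => n _.
by rewrite -!EFinM term_ge.
Qed.

Definition comps_in F H (B : set nat) : graph_family :=
  fun V G => F V G /\ B (num_comp_iso G (urepr H)).

Lemma egf_comps_in_esum F H B :
  egf (comps_in F H B) = (\esum_(k in B) egf (with_comps F (urepr H) k))%E.
Proof.
rewrite egf_esum.
rewrite (@esum_partition _ _ _
  (fun G => num_comp_iso (tagged G) (urepr H)) _ B); first last.
- by move=> G _; exact: lweight_ge0.
- by move=> G [].
apply: eq_esum => k Bk; rewrite egf_esum; congr esum.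
apply/seteqP; split=> [G [[FG _] Gk]//|G [FG Gk]] /=.
by split => //; split => //; rewrite Gk.
Qed.

(** Iterating the recurrence gives mu(H)^k / k! times the value for k = 0; the exponential cancels
    the normalising factor in [poisson_pmf]. *)
Lemma egf_poisson F H k : iso_closed F -> connected_graph (urepr H) ->
  removal_closed F (urepr H) ->
  egf (with_comps F (urepr H) k) =
  ((poisson_pmf (mu H) k)%:E *
   ((expR (mu H))%:E * egf (with_comps F (urepr H) 0)))%E.
Proof.
move=> Fiso Hconn FH; elim: k => [|k IH].
  rewrite /poisson_pmf mu_gt0 expr0 fact0 divr1 mul1r muleA -EFinM.
  by rewrite -expRD addNr expR0 mul1e.
have := egf_with_comps k Fiso Hconn FH; rewrite IH => h.
have : (k.+1%:R^-1%:E * (k.+1%:R%:E * egf (with_comps F (urepr H) k.+1)) =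
  egf (with_comps F (urepr H) k.+1))%E.
  by rewrite muleA -EFinM mulVf ?pnatr_eq0// mul1e.
rewrite h => <-; rewrite 2!muleA -!EFinM; congr (_%:E * _)%E.
rewrite /poisson_pmf mu_gt0 factS natrM exprS.
move: (mu H) => m; rewrite invfM !mulrA; congr (_ / _ * _).
by rewrite -mulrA mulrC.
Qed.

Lemma egf_comps_in F H B : iso_closed F -> connected_graph (urepr H) ->
  removal_closed F (urepr H) -> (egf F < +oo)%E ->
  egf (comps_in F H B) = (Po (mu H) B * egf F)%E.
Proof.
move=> Fiso Hconn FH Ffin.
pose D := ((expR (mu H))%:E * egf (with_comps F (urepr H) 0))%E.
have D0 : (0 <= D)%E by rewrite mule_ge0 ?egf_ge0 ?lee_fin ?expR_ge0.
have FT : egf F = egf (comps_in F H setT).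
  by rewrite !egf_esum; congr esum; apply/seteqP; split=> G /=; [split | case].
(* The class without components of type H gives one of the non-negative terms of the finite sum for
   F. *)
have W0 : egf (with_comps F (urepr H) 0) \is a fin_num.
  rewrite ge0_fin_numE ?egf_ge0//; apply: le_lt_trans Ffin.
  rewrite FT egf_comps_in_esum; apply: esum_ge; exists [set 0%N].
    by split=> //; exact: finite_set1.
  by rewrite fsbig_set1.
have Dfin : D \is a fin_num by rewrite fin_numM.
have Bpo C : egf (comps_in F H C) = (D * Po (mu H) C)%E.
  rewrite egf_comps_in_esum /Po /poisson_prob mu_gt0 -(fineK Dfin) -esumZl.
  - by apply: eq_esum => k _; rewrite egf_poisson// muleC fineK.
  - exact: fine_ge0.
  - by move=> k; rewrite lee_fin poisson_pmf_ge0.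
(* The constant D does not depend on B, and B = [setT] identifies it with the generating function of
   F, as Poisson masses sum to 1. *)
rewrite FT !Bpo muleC; congr (_ * _)%E.
by rewrite /Po (@probability_setT _ _ _ (poisson_prob (mu H) 0)) mule1.
Qed.

End Egf.

(** * Independence *)

Section Restriction.
Variables (A : graph_family) (B : ugraph -> set nat).
Hypotheses (A_iso : iso_closed A) (A_dec : decomposable A).

Definition comps_in_all (s : seq ugraph) : graph_family :=
  fun V G => A G /\
    forall K, K \in s -> B K (num_comp_iso G (urepr K)).

Lemma comps_in_all_iso_closed s : iso_closed (comps_in_all s).
Proof.
move=> V W G H GH [AG Bs]; split; first exact: A_iso AG.
by move=> K /Bs; rewrite (num_comp_iso_isomorphic _ GH).
Qed.

Lemma connected_members_urepr H : unlabelled (connected_members A) H ->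
  A (urepr H) /\ connected_graph (urepr H).
Proof.
apply: (proj1 (unlabelledP H _)) => V W G K GK [AG Gc]; split.
  exact: A_iso AG.
exact: connected_isomorphic Gc.
Qed.

(** A component of G is either C or a component of the rest, and C lies in the class because H
    does. *)
Lemma removal_closed_dec (W : finType) (H : sgraph W) :
  A H -> removal_closed A H.
Proof.
move=> AH V G C CG GH; have GC := component_split_at CG.
have AC : A (induced_subgraph G C) by exact: A_iso (isomorphic_sym GH) AH.
have GC' : split_at G (~: C)%SET by rewrite split_atC.
split=> [/A_dec AG|AG].
  apply/A_dec => K KG; apply: A_iso (isomorphic_sym (induced_induced G K)) _.
  by apply: AG; rewrite component_induced.
apply/A_dec => K KG; have /set0Pn[x xK] := components_neq0 KG.
have [xC|xC] := boolP (x \in C).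
  have [|K' K'G ->] := component_imset_induced GC KG; first by exists x.
  by apply: A_iso (induced_induced G K') _; move/A_dec: AC; apply.
have [|K' K'G ->] := component_imset_induced GC' KG.
  by exists x; rewrite // inE.
by apply: A_iso (induced_induced G K') _; move/A_dec: AG; apply.
Qed.

(** Deleting a copy of H leaves the count of every type K in [s] unchanged: K differs from H as an
    unlabelled graph, so the deleted component is not isomorphic to K. *)
Lemma removal_closed_comps_in_all s H :
  unlabelled (connected_members A) H -> H \notin s ->
  removal_closed (comps_in_all s) (urepr H).
Proof.
move=> /connected_members_urepr[AH Hc] Hs V G C CG GH.
have compE K : K \in s -> num_comp_iso G (urepr K) =
    num_comp_iso (induced_subgraph G (~: C)) (urepr K).
  move=> Ks; rewrite (num_comp_iso_split (component_split_at CG)).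
  rewrite num_comp_iso_connected; last by case/in_componentsE: CG.
  case: asboolP => // GK; case/negP: Hs; rewrite (@isomorphic_urepr_inj H K)//.
  exact: isomorphic_trans (isomorphic_sym GH) GK.
have AC := removal_closed_dec AH CG GH.
split=> -[/AC AG Bs]; split=> // K Ks.
  by rewrite -compE//; exact: Bs.
by rewrite compE//; exact: Bs.
Qed.

Variables (R : realType) (lambda nu rho : R).
Hypotheses (lambda_gt0 : 0 < lambda) (nu_gt0 : 0 < nu) (rho_gt0 : 0 < rho).
Hypothesis A_fin : (egf A rho lambda nu < +oo)%E.

Lemma egf_comps_in_all s : uniq s ->
  (forall H, H \in s -> unlabelled (connected_members A) H) ->
  egf (comps_in_all s) rho lambda nu =
  (\prod_(H <- s) Po (mu rho lambda nu H) (B H) * egf A rho lambda nu)%E.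
Proof.
have egf_eq (F G : graph_family) : (forall V K, F V K <-> G V K) ->
    egf F rho lambda nu = egf G rho lambda nu.
  move=> FG; rewrite !egf_esum//; congr esum.
  by apply/seteqP; split=> K /= /FG.
elim: s => [_ _|H s IH /= /andP[Hs us] Hin].
  rewrite big_nil mul1e; apply: egf_eq => V K.
  by split=> [[]//|AK]; split.
have {}IH := IH us (fun K Ks => Hin K (@mem_behead _ (H :: s) K Ks)).
have UH := Hin H (mem_head _ _); have [AH Hc] := connected_members_urepr UH.
(* The finiteness required to add the constraint on H comes from the product formula already
   obtained for [s]. *)
have fin : (egf (comps_in_all s) rho lambda nu < +oo)%E.
  rewrite IH -ge0_fin_numE; last first.
    apply: mule_ge0; last exact: egf_ge0.
    apply: prode_ge0 => K _.
    exact: (measure_ge0 (poisson_prob (mu rho lambda nu K) 0)).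
  apply: fin_numM; last by rewrite ge0_fin_numE ?egf_ge0.
  apply: prode_fin_num => K _.
  exact: (fin_num_measure (poisson_prob (mu rho lambda nu K) 0)).
rewrite big_cons -muleA -IH -egf_comps_in//.
- apply: egf_eq => V K; split=> [[AK Bs]|[[AK Bs] BH]]; split=> //.
  + by split=> // L Ls; apply: Bs; rewrite inE Ls orbT.
  + by apply: Bs; exact: mem_head.
  + by move=> L; rewrite inE => /predU1P[->//|]; exact: Bs.
- exact: comps_in_all_iso_closed.
- exact: removal_closed_comps_in_all.
Qed.

End Restriction.

Theorem theorem2p1 (R : realType) (A : graph_family)
    (A_iso : iso_closed A) (A_dec : decomposable A)
    (lambda nu rho : R) (lambda_gt0 : 0 < lambda) (nu_gt0 : 0 < nu)
    (rho_gt0 : 0 < rho) (A_fin : (egf A rho lambda nu < +oo)%E) :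
  egf A rho lambda nu
    = \esum_(H in unlabelled A) (mu rho lambda nu H)%:E
  /\
  forall (d : measure_display) (T : measurableType d) (P : probability T R)
         (RA : {mfun T >-> ugraph}),
    (forall t : T, unlabelled A (RA t)) ->
    (forall H : ugraph, unlabelled A H ->
       P (RA @^-1` [set H])
         = (mu rho lambda nu H / fine (egf A rho lambda nu))%:E) ->
    mutually_independent P (unlabelled (connected_members A))
      (fun H => (ucomp_iso H \o RA : {mfun T >-> nat}))
    /\
    (forall H : ugraph, unlabelled (connected_members A) H ->
       forall B : set nat,
         distribution P (ucomp_iso H \o RA : {mfun T >-> nat}) B
           = Po (mu rho lambda nu H) B).
Proof.
split; first exact: egf_unlabelled.
move=> d T P RA RA_A RA_mu; set Z := egf A rho lambda nu.
have Z0 : (0 <= Z)%E by exact: egf_ge0.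
have prE F : iso_closed F -> (forall V (G : sgraph V), F V G -> A V G) ->
    P (RA @^-1` unlabelled F) = ((fine Z)^-1%:E * egf F rho lambda nu)%E.
  move=> Fiso FA; rewrite measure_preimage_countable; last first.
    by move=> H; rewrite -[_ @^-1` _]setTI; exact: measurable_funP.
  rewrite egf_unlabelled// -esumZl; first last.
  - by move=> H; rewrite lee_fin ltW// mu_gt0.
  - by rewrite invr_ge0 fine_ge0.
  apply: eq_esum => H /(unlabelledP _ Fiso)/FA AH.
  by rewrite -EFinM mulrC; apply: RA_mu; exact/unlabelledP.
(* This is the case F = A of [prE]: [RA] always lies in A, so the total probability is 1. *)
have Z1 : ((fine Z)^-1%:E * Z = 1)%E.
  rewrite -prE// -[RHS](@probability_setT _ _ _ P); congr (P _).
  by apply/seteqP; split=> t //= _; exact: RA_A.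
(* The intersection is the event that [RA] falls in the class [comps_in_all A B s]. *)
have joint (B : ugraph -> set nat) (s : seq ugraph) : uniq s ->
    (forall H, H \in s -> unlabelled (connected_members A) H) ->
    P (\bigcap_(H in [set` s]) (ucomp_iso H \o RA) @^-1` B H) =
    (\prod_(H <- s) Po (mu rho lambda nu H) (B H))%E.
  move=> us sC; have Fiso : iso_closed (comps_in_all A B s).
    exact: comps_in_all_iso_closed.
  transitivity ((fine Z)^-1%:E * egf (comps_in_all A B s) rho lambda nu)%E;
    last first.
    by rewrite egf_comps_in_all// muleCA Z1 mule1.
  rewrite -prE//; last by move=> V G [].
  congr (P _); apply/seteqP; split=> t /=.
    move=> Bt; apply/unlabelledP => //.
    by split; [exact/unlabelledP | exact: Bt].
  by move/(unlabelledP _ Fiso) => [_ Bt] H; exact: Bt.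
(* The marginal law is the joint law for a one-element list. *)
have marginal (B : set nat) H : unlabelled (connected_members A) H ->
    P ((ucomp_iso H \o RA) @^-1` B) = Po (mu rho lambda nu H) B.
  move=> HC; have := joint (fun=> B) [:: H]; rewrite big_seq1 => <-//.
    by rewrite set_cons1 bigcap_set1.
  by move=> K; rewrite inE => /eqP ->.
split=> [J B JC _|H HC B]; last exact: marginal.
rewrite (joint B J (fset_uniq J) JC); apply: eq_big_seq => H /JC HC.
exact/esym/marginal.
Qed.
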